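(* Let $\alpha=(\alpha_1,\dots,\alpha_\ell)$ be a strong composition. (1) If there exist $i<j<k$ with $\alpha_i<\alpha_j<\alpha_k$, then $\kappa_\alpha$ is not multiplicity free. (2) If there exist $i<j<k<l$ with $\alpha_i<\alpha_l$, $\alpha_j<\alpha_l$ and $\alpha_l<\alpha_k$, then $\kappa_\alpha$ is not multiplicity free. (3) If there exist $i<j<k<l$ with $\alpha_i<\alpha_k$, $\alpha_j+1<\alpha_k$ and $\alpha_k=\alpha_l$, then $\kappa_\alpha$ is not multiplicity free.
   Context: A weak composition $a=(a_1,\dots,a_\ell)$ of length $\ell$ is a finite sequence of nonnegative integers; a strong composition is one whose parts are all positive. A diagram is a finite set of cells $(r,c)$ with $r,c$ positive integers, the cell $(r,c)$ lying in row $r$ (counted from the bottom) and column $c$ (counted from the left). A Kohnert tableau of content $a$ is a diagram whose cells are filled with positive integers, with exactly $a_i$ cells containing $i$ for each $i$, such that: (i) for each $i$ there is exactly one $i$ in each of the columns $1,\dots,a_i$; (ii) every entry in row $r$ is at least $r$; (iii) for each $i$, the cells containing $i$ weakly descend from left to right; (iv) if $i<j$ appear in the same column with $i$ above $j$, then there is an $i$ in the column immediately to the right of the cell containing that $j$, in a row strictly above it. It is quasi-Yamanouchi if moreover (v) for each nonempty row $r$, either row $r$ contains an entry equal to $r$, or some cell of row $r+1$ lies weakly to the right of some cell of row $r$. Let $\mathrm{QKT}(a)$ be the set of quasi-Yamanouchi Kohnert tableaux of content $a$, and $\mathrm{wt}(T)$ the weak composition of length $\ell$ whose $r$-th part is the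 number of cells in row $r$ of $T$. The key polynomial $\kappa_a$ (the sum of $x^{\mathrm{wt}(T)}$ over all Kohnert tableaux $T$ of content $a$) satisfies $\kappa_a=\sum_{T\in\mathrm{QKT}(a)}\mathfrak{F}_{\mathrm{wt}(T)}$, where $\mathfrak{F}_b$ denotes the fundamental slide polynomial. We say $\kappa_a$ is multiplicity free if distinct tableaux in $\mathrm{QKT}(a)$ have distinct weights. *)

(* Defs.v *)
From mathcomp Require Import all_boot finmap.

Set Implicit Arguments.
Unset Strict Implicit.
Unset Printing Implicit Defensive.

Local Open Scope fset_scope.
Local Open Scope fmap_scope.

Definition wcomp := seq nat.

(* Parts are numbered from 1: [part a i] is a_i for 1 <= i <= size a, and it is
   0 for every other i (in particular for i = 0). *)
Definition part (a : wcomp) (i : nat) : nat := nth 0 (0 :: a) i.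

Definition strong (a : wcomp) : bool := all (fun p => 0 < p) a.

(* A cell is a pair (row, column); the domain [domf T] of a filling is its
   diagram, and equality of such finite maps is equality of filled diagrams. *)
Definition filling := {fmap nat * nat -> nat}.

Definition filled_with (T : filling) (r c i : nat) : Prop :=
  T.[? (r, c)] = Some i.

Definition positive_filling (T : filling) : Prop :=
  forall r c, (r, c) \in domf T ->
    [/\ 0 < r, 0 < c & exists2 i, 0 < i & filled_with T r c i].

Definition has_content (a : wcomp) (T : filling) : Prop :=
  forall i, 0 < i -> #|` [fset p in domf T | T.[? p] == Some i]| = part a i.

Definition kohnert_tableau (a : wcomp) (T : filling) : Prop :=
  [/\ positive_filling T /\ has_content a T,
      forall i c, 0 < i -> 0 < c <= part a i ->
        exists! r, filled_with T r c i,
      forall r c i, filled_with T r c i -> r <= i,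
      forall i r c r' c', filled_with T r c i -> filled_with T r' c' i ->
        c < c' -> r' <= r
    & forall i j c r r', i < j ->
        filled_with T r c i -> filled_with T r' c j -> r' < r ->
        exists2 r'', r' < r'' & filled_with T r'' c.+1 i].

Definition quasi_yamanouchi (T : filling) : Prop :=
  forall r, (exists c, (r, c) \in domf T) ->
    (exists c, filled_with T r c r) \/
    (exists c c', [/\ (r, c) \in domf T, (r.+1, c') \in domf T & c <= c']).

Definition QKT (a : wcomp) (T : filling) : Prop :=
  kohnert_tableau a T /\ quasi_yamanouchi T.

Definition wt (a : wcomp) (T : filling) : wcomp :=
  [seq #|` [fset p in domf T | p.1 == r]| | r <- iota 1 (size a)].

(* Multiplicity freeness of the key polynomial kappa_a, whose expansion into
   fundamental slide polynomials has one term F_(wt T) for each T in QKT(a). *)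
Definition key_multiplicity_free (a : wcomp) : Prop :=
  forall T U : filling, QKT a T -> QKT a U -> wt a T = wt a U -> T = U.

(* Main.v *)
(* Since alpha is strong, every label m occurs in column 1, in a row <= m, so
   label m sits in row m of column 1: the quasi-Yamanouchi condition is automatic
   and it is enough to find two distinct Kohnert tableaux of the same weight.
   They are obtained from the tableau with every m in row m by moving the last
   cells of some labels and the penultimate cell of at most one label. Write
   "k -> i in column c" for exchanging row k of column c for row i, which makes
   all the labels in {i+1, ..., k} ending in column c slide down along each other.
   (1) Compare "j -> i in column alpha_j, k -> j in column alpha_k" with
       "k -> i in column alpha_k".
   (2) Take k and l first possible after j and k, put d = alpha_l, e = alpha_k.
       If some label strictly between i and k has d cells, (1) applies. Otherwise
       compare "l -> i in column d, k -> j in column e" with "l -> j in column d,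
       k -> i in column e"; if e = d + 1 the latter diagram is labelled
       by letting l take row k and k take row j in column d.
   (3) Take k and l first possible again, put e = alpha_k = alpha_l; if some label
       strictly between j and k has e - 1 cells, (1) applies. Otherwise compare
       "k -> j in column e - 1, l -> i in column e" with "k -> i and l -> j in
       column e". *)

Require Import Defs.
From mathcomp Require Import all_boot finmap zify.

Set Implicit Arguments.
Unset Strict Implicit.
Unset Printing Implicit Defensive.

Local Open Scope fset_scope.
Local Open Scope nat_scope.

Lemma part_gt0 (a : wcomp) i : 0 < part a i -> 0 < i <= size a.
Proof.
case: i => [|i] //; rewrite /part /= => h.
by rewrite ltnNge; apply/negP => le; rewrite nth_default in h.
Qed.

Lemma part_strong (a : wcomp) i : strong a -> 0 < i <= size a -> 0 < part a i.
Proof. by case: i => [|i] // /all_nthP st /= lt; apply: st. Qed.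

(** * Tableaux given by the row of each label in each column *)

Section Tableau.

Variables (a : wcomp) (R : nat -> nat -> nat).

Definition cells : seq (nat * nat) :=
  [seq (R m c, c) | m <- iota 1 (size a), c <- iota 1 (part a m)].

Definition label (p : nat * nat) : nat :=
  head 0 [seq m <- iota 1 (size a) | (p.2 <= part a m) && (R m p.2 == p.1)].

Definition tableau : filling :=
  [fmap p : [fset x in cells] => label (val p)]%fmap.

Lemma mem_cells p :
  reflect (exists m, 0 < p.2 <= part a m /\ p.1 = R m p.2) (p \in cells).
Proof.
apply: (iffP allpairsPdep) => [[m [c [_ ic ->]]]|[m [hc e]]].
  by exists m; move: ic; rewrite mem_iota /= => h; split=> //; lia.
exists m, p.2; rewrite !mem_iota -e; split; [|lia|exact: surjective_pairing].
by have := @part_gt0 a m; lia.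
Qed.

Lemma mem_domf p :
  reflect (exists m, 0 < p.2 <= part a m /\ p.1 = R m p.2) (p \in domf tableau).
Proof. by rewrite inE; exact: mem_cells. Qed.

(** [row_neq] makes the filling single-valued; [row_cross] is the condition on a smaller label above
    a larger one. *)
Record row_system : Prop := RowSystem {
  row_bound m c : 0 < c <= part a m -> 0 < R m c <= m;
  row_anti m c : 0 < c < part a m -> R m c.+1 <= R m c;
  row_neq p q c : p < q -> 0 < c <= part a p -> c <= part a q -> R p c != R q c;
  row_cross p q c : p < q -> 0 < c <= part a p -> c <= part a q ->
    R q c < R p c -> c < part a p /\ R q c < R p c.+1 }.

Hypothesis RS : row_system.

Lemma row_inj p q c : 0 < c <= part a p -> 0 < c <= part a q ->
  R p c = R q c -> p = q.
Proof.
move=> hp hq e; case: (ltngtP p q) => // lt.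
  by have := row_neq RS lt hp (proj2 (andP hq)); rewrite e eqxx.
by have := row_neq RS lt hq (proj2 (andP hp)); rewrite e eqxx.
Qed.

Lemma filled_tableau r c i :
  filled_with tableau r c i <-> 0 < c <= part a i /\ r = R i c.
Proof.
have labE m : 0 < c <= part a m -> label (R m c, c) = m.
  move=> hm; rewrite /label; set s := filter _ _.
  have ms : m \in s.
    by rewrite mem_filter mem_iota /= eqxx; have := @part_gt0 a m; lia.
  have : head 0 s \in s by case: s ms => //= x s _; rewrite inE eqxx.
  rewrite mem_filter /= => /andP[/andP[le /eqP e] _].
  by apply: row_inj e => //; lia.
rewrite /filled_with; split=> [h|[hc ->]].
  have hd : (r, c) \in domf tableau by rewrite -fndSome h.
  have /mem_domf[m [/= hm e]] := hd.
  move: h; rewrite (in_fnd hd) ffunE /= e labE // => -[<-].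
  by split.
have hd : (R i c, c) \in domf tableau by apply/mem_domf; exists i.
by rewrite (in_fnd hd) ffunE /= labE.
Qed.

Lemma uniq_cells : uniq cells.
Proof.
apply: allpairs_uniq_dep; [exact: iota_uniq | by move=> x _; exact: iota_uniq |].
move=> _ _ /allpairsPdep[m [c [_ hc ->]]] /allpairsPdep[m' [c' [_ hc' ->]]] /=.
case=> e ec; move: hc hc' e; rewrite -{}ec !mem_iota => hc hc' e.
by have -> : m = m' by apply: row_inj e; lia.
Qed.

Lemma content_tableau : has_content a tableau.
Proof.
move=> i i0; rewrite -[RHS](size_iota 1) -(size_map (fun c => (R i c, c))).
set s := map _ _; have us : uniq s.
  by rewrite map_inj_in_uniq ?iota_uniq // => x y _ _ [].
rewrite -(undup_id us) -card_fseq; congr #|` _|; apply/fsetP => -[r c].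
rewrite !inE /=; apply/andP/mapP => [[_ /eqP/filled_tableau[hc ->]]|[c']].
  by exists c; rewrite // mem_iota; lia.
rewrite mem_iota => hc [-> ->]; split; last first.
  by apply/eqP/filled_tableau; split=> //; lia.
by apply/mem_cells; exists i; split=> //=; lia.
Qed.


Lemma kohnert_tableau_row_system : kohnert_tableau a tableau.
Proof.
split.
- split; last exact: content_tableau.
  move=> r c /mem_domf[m [/= hm ->]].
  have /andP[lt0 _] := row_bound RS hm.
  split; [by [] | by lia |].
  exists m; last exact/filled_tableau.
  by have := @part_gt0 a m; lia.
- move=> i c _ hc; exists (R i c); split; first exact/filled_tableau.
  by move=> r /filled_tableau[].
- move=> r c i /filled_tableau[hc ->].
  by have := row_bound RS hc; lia.
- move=> i r c r' c' /filled_tableau[hc ->] /filled_tableau[hc' ->] lt.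
  have [d e] : exists d, c' = c + d by exists (c' - c); lia.
  rewrite {c' lt}e in hc' *; elim: d hc' => [|d IH] hd; first by rewrite addn0.
  rewrite addnS; apply: leq_trans (IH _); last by lia.
  by apply: (row_anti RS); lia.
- move=> i j c r r' lt /filled_tableau[hi ->] /filled_tableau[hj ->] h.
  have [|lc h'] := row_cross RS lt hi _ h; first by lia.
  by exists (R i c.+1) => //; apply/filled_tableau.
Qed.

Hypothesis sa : strong a.

(* All labels occur in the first column, and none of them lies above its own
   row, so there is only one way to place them. *)
Lemma row_first_column m : 0 < m <= size a -> R m 1 = m.
Proof.
elim/ltn_ind: m => m IH hm.
have am := part_strong sa hm.
have hR : 0 < R m 1 <= m by apply: (row_bound RS); lia.
apply/eqP; rewrite eqn_leq (proj2 (andP hR)) leqNgt; apply/negP => lt.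
have hs : 0 < R m 1 <= size a by lia.
have := row_neq RS lt (c := 1); rewrite (IH _ lt hs) eqxx.
by have := part_strong sa hs; lia.
Qed.

Lemma QKT_row_system : QKT a tableau.
Proof.
split; first exact: kohnert_tableau_row_system.
move=> r [c /mem_domf[m [/= hm er]]]; left; exists 1.
have := row_bound RS hm; rewrite -er => hr.
have hs : 0 < r <= size a by have := @part_gt0 a m; lia.
apply/filled_tableau; split; last by rewrite row_first_column.
by have := part_strong sa hs; lia.
Qed.

Lemma wt_tableau : wt a tableau =
  [seq \sum_(1 <= m < (size a).+1) \sum_(1 <= c < (part a m).+1) (R m c == r)
  | r <- iota 1 (size a)].
Proof.
apply/eq_in_map => r _; set F := (X in size (enum_fset X)).
have -> : F = [fset x in [seq p <- cells | p.1 == r]].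
  by apply/fsetP => p; rewrite !inE mem_filter andbC.
rewrite card_fseq undup_id ?filter_uniq ?uniq_cells // size_filter.
rewrite -sum1_count /cells big_mkcond big_allpairs_dep /index_iota subn1 /=.
apply: eq_bigr => m _; rewrite subn1 /=.
by apply: eq_bigr => c _; case: eqP.
Qed.

End Tableau.

(** * Weights of tableaux with few moved cells *)

(* Only the last cell of each label and the penultimate cell of one label [k]
   ever have to be moved. *)
Definition rows (a : wcomp) (f : nat -> nat) (k h m c : nat) : nat :=
  if c == part a m then f m
  else if (m == k) && (c.+1 == part a m) then h else m.

(** Separates the last cells, the penultimate cell of [k] and all others. The final sum does not
    involve [f] or [h], so it cancels when weights are compared. *)
Lemma sum_rows (a : wcomp) f k h r :
    strong a -> 1 < part a k ->
  \sum_(1 <= m < (size a).+1) \sum_(1 <= c < (part a m).+1)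
     (rows a f k h m c == r) =
  \sum_(1 <= m < (size a).+1) (f m == r) + (h == r) +
  \sum_(1 <= m < (size a).+1) ((part a m).-1 - (m == k)) * (m == r).
Proof.
move=> sa ak.
have -> : nat_of_bool (h == r) = \sum_(1 <= m < (size a).+1) (m == k) * (h == r).
  have hk : k \in index_iota 1 (size a).+1.
    by rewrite mem_index_iota; have := @part_gt0 a k; lia.
  by rewrite (bigD1_seq k) ?iota_uniq //= eqxx mul1n big1 ?addn0 // => m /negPf->.
rewrite -!big_split /=; apply: eq_big_nat => m hm.
have am : 0 < part a m by apply: part_strong; lia.
rewrite /rows big_nat_recr //= eqxx addnC -addnA; congr addn.
have const x y : \sum_(1 <= c < y.+1) (x == r :> nat) = y * (x == r).
  by rewrite sum_nat_const_nat subn1.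
case: (eqVneq m k) => [->|mk] /=.
  case: (part a k) ak => [|[|p]] // _.
  rewrite big_nat_recr //= eqxx (ltn_eqF (ltnSn _)) mul1n addnC subn1 /= -const.
  congr addn; apply: eq_big_nat => c hc.
  by rewrite (ltn_eqF (_ : c < p.+2)) 1?(ltn_eqF (_ : c.+1 < p.+2)) //; lia.
case: (part a m) am => [|p] // _ /=.
rewrite mul0n add0n subn0 -const; apply: eq_big_nat => c hc.
by rewrite (ltn_eqF (_ : c < p.+1)) //; lia.
Qed.

Lemma not_multiplicity_free (a : wcomp) (k h h' : nat) (f f' : nat -> nat) m :
    strong a -> 1 < part a k ->
    row_system a (rows a f k h) -> row_system a (rows a f' k h') ->
    (forall r, \sum_(1 <= m < (size a).+1) (f m == r) + (h == r) =
               \sum_(1 <= m < (size a).+1) (f' m == r) + (h' == r)) ->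
    0 < part a m -> f m != f' m ->
  ~ key_multiplicity_free a.
Proof.
move=> sa ak RS RS' e am ne free.
have TU : tableau a (rows a f k h) = tableau a (rows a f' k h').
  apply: free; try exact: QKT_row_system.
  by rewrite !wt_tableau //; apply: eq_map => r; rewrite !sum_rows // e.
have : filled_with (tableau a (rows a f k h)) (f m) (part a m) m.
  by apply/filled_tableau; rewrite // /rows eqxx am leqnn.
rewrite TU => /(filled_tableau RS')[_].
by rewrite /rows eqxx; apply/eqP.
Qed.

(** * Conditions on the moved cells *)

Section Valid.

Variables (a : wcomp) (f : nat -> nat) (k h : nat).

(** The row-system axioms, sorted by which cells of [p < q] in one column are moved. [valid_free]
    excepts the row left by the penultimate cell of [k]; [valid_short], [valid_long] and
    [valid_h_free] treat the column of that cell, [valid_h_above] the column before it. *)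
Record valid : Prop := Valid {
  valid_bound m : 0 < m -> 0 < part a m -> 0 < f m <= m;
  valid_h : f k <= h <= k;
  valid_mono p q : 0 < p < q -> part a p = part a q -> f p < f q;
  valid_free p q : 0 < p < q -> 0 < part a q < part a p ->
    f q = p -> p = k /\ h < k /\ part a p = (part a q).+1;
  valid_above p q : 0 < p < q -> 0 < part a q -> part a p = (part a q).+1 ->
    f q < p -> f q < f p;
  valid_short p : 0 < p < k -> 0 < part a p -> part a k = (part a p).+1 -> f p < h;
  valid_long p : 0 < p < k -> part a k <= part a p -> h <> p /\
    (part a k = part a p -> h < p -> h < f p);
  valid_h_free q : k < q -> 0 < part a q -> part a k = (part a q).+1 -> f q <> h;
  valid_h_above q : k < q -> 0 < part a q -> part a k = (part a q).+2 ->
    f q < k -> f q < h }.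

Variant rows_spec m c : nat -> Prop :=
| RowsLast of c = part a m : rows_spec m c (f m)
| RowsPenultimate of m = k & c.+1 = part a m : rows_spec m c h
| RowsOwn of c < part a m & (m = k -> c.+1 < part a m) : rows_spec m c m.

Lemma rowsP m c : c <= part a m -> rows_spec m c (rows a f k h m c).
Proof.
move=> hc; rewrite /rows; case: ifP => [/eqP|cm]; first by constructor.
case: ifP => [/andP[/eqP km /eqP]|km]; first by constructor.
by constructor; lia.
Qed.

Lemma valid_row_system : 0 < part a k -> valid -> row_system a (rows a f k h).
Proof.
move=> ak [Vb Vh Vm Vf Va Vs Vl Vhf Vha].
have pos m c : 0 < c <= part a m -> 0 < m by have := @part_gt0 a m; lia.
have k0 : 0 < k by apply: (pos k 1); lia.
have Vbk : 0 < f k by have := Vb k k0; lia.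
split.
- move=> m c hc; have m0 := pos _ _ hc.
  have bm := Vb m m0.
  by case: (rowsP (proj2 (andP hc))) => *; lia.
- move=> m c hc; have m0 : 0 < m by apply: (pos m c); lia.
  have bm := Vb m m0.
  have [le lt] : c <= part a m /\ c.+1 <= part a m by lia.
  case: (rowsP le) => [e|e e1|e e1]; case: (rowsP lt) => [e'|e' e1'|e' e1'];
    try (subst m); by lia.
- move=> p q c lt hp hq; have p0 := pos _ _ hp.
  have [lpq cp] : 0 < p < q /\ c <= part a p by lia.
  have bp := Vb p p0.
  case: (rowsP cp) => [ep|ep e1|e1 e2].
  + case: (rowsP hq) => [eq|eq e3|e3 e4].
    * by have := Vm p q lpq; lia.
    * by subst q; have := Vs p lpq; lia.
    * by lia.
  + subst p; case: (rowsP hq) => [eq|eq e3|e3 e4].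
    * by have := Vhf q lt; lia.
    * by lia.
    * by lia.
  + case: (rowsP hq) => [eq|eq e3|e3 e4].
    * by have := Vf p q lpq; lia.
    * by subst q; have := Vl p lpq; lia.
    * by lia.
- move=> p q c lt hp hq; have p0 := pos _ _ hp.
  have [lpq cp] : 0 < p < q /\ c <= part a p by lia.
  have bp := Vb p p0.
  case: (rowsP cp) => [ep|ep e1|e1 e2].
  + case: (rowsP hq) => [eq|eq e3|e3 e4].
    * by have := Vm p q lpq; lia.
    * by subst q; have := Vs p lpq; lia.
    * by lia.
  + subst p; case: (rowsP hq) => [eq|eq e3|e3 e4]; try by lia.
    rewrite /rows e1 eqxx.
    (* As [h <= k], a cell of [q] below row [h] is below row [k], so [valid_above] applies. *)
    by have := Va k q lpq; lia.
  + move=> h'; split=> //; move: h'.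
    case: (rowsP e1) => [e3|e3 e4|e3 e4];
      case: (rowsP hq) => [eq|eq e5|e5 e6]; try by lia.
    * by have := Va p q lpq; lia.
    * by subst q; have := Vl p lpq; lia.
    * by subst p; have := Vha q lt; lia.
Qed.

End Valid.

Lemma valid_unmoved (a : wcomp) (f : nat -> nat) (k : nat) :
    0 < part a k ->
    (forall m, 0 < m -> 0 < part a m -> 0 < f m <= m) ->
    (forall p q, 0 < p < q -> part a p = part a q -> f p < f q) ->
    (forall p q, 0 < p < q -> 0 < part a q < part a p -> f q <> p) ->
    (forall p q, 0 < p < q -> 0 < part a q -> part a p = (part a q).+1 ->
      f q < p -> f q < f p) ->
  valid a f k k.
Proof.
move=> ak Vb Vm Vf Va; have k0 : 0 < k by have := @part_gt0 a k; lia.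
have Vbk := Vb k k0; split=> //.
- by lia.
- by move=> p q lpq apq e; have := Vf p q lpq apq; lia.
- by move=> p hp ap _; have := Vb p; lia.
- by move=> p hp; split=> *; lia.
- by move=> q lt aq e; apply: Vf; lia.
Qed.

(** * Sliding labels of equal part along each other *)

Section Shift.

Variables (a : wcomp) (i e : nat).

(** The default [i] sends the first label of the chain to row [i]. *)
Fixpoint last_part (n : nat) : nat :=
  if n is n'.+1 then
    if (i < n) && (part a n == e) then n else last_part n'
  else i.

(* The labels in {i+1, ..., k} with part [e] slide down along their own rows; the net
   effect on their last column is that row [k] is exchanged for row [i]. *)
Definition shift (k m : nat) : nat :=
  if (i < m <= k) && (part a m == e) then last_part m.-1 else m.

Lemma last_partP n : i <= n ->
  [/\ i <= last_part n <= n,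
      last_part n = i \/ i < last_part n /\ part a (last_part n) = e
    & forall p, last_part n < p <= n -> part a p <> e].
Proof.
elim: n => [|n IH] hi /=; first by split; [lia | left; lia | lia].
case: ifP => [/andP[lt /eqP ae]|h]; first by split; [lia | right | lia].
have [hin|hin] := leqP i n; last first.
  have -> : last_part n = n.+1.
    have -> : n.+1 = i by lia.
    elim: n hin {IH hi h} => //= n IH lt; rewrite IH; last by lia.
    by case: ifP => //; lia.
  by split; [lia | left; lia | lia].
have [h1 h2 h3] := IH hin; split=> //; first by lia.
move=> p hp; have [le|lt] := leqP p n; first by apply: h3; lia.
have -> : p = n.+1 by lia.
by move: h; rewrite ltnS hin /= => /eqP.
Qed.

Variant shift_spec (k m : nat) : nat -> Prop :=
| ShiftMove s of i < m <= k & part a m = e & i <= s < m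
    & s = i \/ i < s /\ part a s = e
    & (forall p, s < p < m -> part a p <> e) : shift_spec k m s
| ShiftKeep of (i < m <= k -> part a m <> e) : shift_spec k m m.

Lemma shiftP k m : shift_spec k m (shift k m).
Proof.
rewrite /shift; case: ifP => [/andP[hm /eqP am]|h]; last first.
  by constructor => hm am; move: h; rewrite hm am eqxx.
have [|h1 h2 h3] := @last_partP m.-1; first by lia.
by constructor=> //; [lia | move=> p hp; apply: h3; lia].
Qed.

(** A moved label lands no lower than the own row of its predecessor in the chain, which has itself
    slid down. As [part a i < e], label [i] cannot collide with the first label of the chain. *)
Lemma shift_mono k p q : part a i < e -> p < q -> part a p = part a q ->
  shift k p < shift k q.
Proof.
move=> ai lt apq.
case: (shiftP k q) => [s hq aq hs hs' none|hq].
  have [le|sp] := leqP p s; last by have := none p; lia.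
  case: (shiftP k p) => [s' hp ap hs1 _ _|hp]; first by lia.
  have ip : p <> i by move=> e1; move: ai apq; rewrite e1; lia.
  by lia.
by case: (shiftP k p) => [s' hp ap hs1 _ _|hp]; lia.
Qed.

Lemma sum_shift k n r : i < k <= n -> part a k = e ->
  \sum_(1 <= m < n.+1) (shift k m == r) + (k == r) =
  \sum_(1 <= m < n.+1) (m == r) + (i == r).
Proof.
move=> hk ak.
(* Telescoping invariant: after the labels up to [N], row [last_part N] has been exchanged for row
   [i]. *)
have main N : N <= k ->
    \sum_(1 <= m < N.+1) (shift k m == r) + (last_part N == r) =
    \sum_(1 <= m < N.+1) (m == r) + (i == r).
  elim: N => [|N IH] hN; first by rewrite !big_geq.
  have step F : \sum_(1 <= m < N.+2) F m = \sum_(1 <= m < N.+1) F m + F N.+1.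
    by rewrite big_nat_recr.
  rewrite !step {2}/shift hN andbT /=.
  by have := IH (ltnW hN); case: ifP => _; lia.
have lk : last_part k = k.
  by case: (k) hk ak => // k' hk ak /=; rewrite ak eqxx andbT; case: ifP; lia.
have := main k (leqnn k); rewrite lk => {main lk}.
rewrite !(big_cat_nat (n := k.+1) (m := 1) (p := n.+1)) /=; try by lia.
have -> : \sum_(k.+1 <= m < n.+1) (shift k m == r) =
          \sum_(k.+1 <= m < n.+1) (m == r).
  by apply: eq_big_nat => m hm; rewrite /shift; case: ifP => //; lia.
by lia.
Qed.

End Shift.

(** * Moving a single last cell *)

Definition update (g : nat -> nat) (l x m : nat) : nat :=
  if m == l then x else g m.

Lemma sum_update (g : nat -> nat) (l x n r : nat) : 0 < l <= n ->
  \sum_(1 <= m < n.+1) (update g l x m == r) + (g l == r) =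
  \sum_(1 <= m < n.+1) (g m == r) + (x == r).
Proof.
move=> hl; have hl' : l \in index_iota 1 n.+1 by rewrite mem_index_iota; lia.
rewrite !(bigD1_seq l hl') ?iota_uniq //= {1}/update eqxx.
rewrite (eq_bigr (fun m => (g m == r) : nat)); first by lia.
by move=> m /negPf ml; rewrite /update ml.
Qed.

(** * Increasing triples *)

Lemma increasing_not_multiplicity_free (a : wcomp) i j k :
    strong a -> 0 < i < j -> j < k -> part a i < part a j < part a k ->
  ~ key_multiplicity_free a.
Proof.
move=> sa hij hjk ha.
pose f m := if m <= j then shift a i (part a j) j m else shift a j (part a k) k m.
pose f' := shift a i (part a k) k.
have hk := @part_gt0 a k.
apply: (@not_multiplicity_free a k k k f f' j) => //; try by lia.
- apply: valid_row_system; first by lia.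
  apply: valid_unmoved; rewrite /f; first by lia.
  + by move=> m m0 am; case: ifP => _; case: shiftP => *; lia.
  + move=> p q lpq apq; case: ifP => hp; case: ifP => hq; try by lia.
    * by apply: shift_mono; lia.
    * case: (eqVneq p j) hp lpq apq => [->|pj] *;
        case: shiftP => *; case: shiftP => *; lia.
    * by apply: shift_mono; lia.
  + move=> p q lpq apq; case: ifP => hq;
      case: shiftP => [s h1 h2 h3 [->|h4] h5|_] e; subst; lia.
  + move=> p q lpq aq apq.
    case: ifP => hq; (case: shiftP => [s h1 h2 h3 _ _|_]; last by lia);
      case: ifP => hp; case: shiftP => *; lia.
- apply: valid_row_system; first by lia.
  apply: valid_unmoved; rewrite /f'; first by lia.
  + by move=> m m0 am; case: shiftP => *; lia.
  + by move=> p q lpq apq; apply: shift_mono; lia.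
  + move=> p q lpq apq.
    case: shiftP => [s h1 h2 h3 [->|h4] h5|_] e; subst; lia.
  + move=> p q lpq aq apq.
    by (case: shiftP => [s h1 h2 h3 _ _|_]; last by lia); case: shiftP => *; lia.
- move=> r; set n := size a; have hn : k <= n by lia.
  have e1 := @sum_shift a i (part a j) j n r.
  have e2 := @sum_shift a j (part a k) k n r.
  have e3 := @sum_shift a i (part a k) k n r.
  (* The two slides move disjoint sets of labels, so their effects add up. *)
  have e4 : \sum_(1 <= m < n.+1) (f m == r) + \sum_(1 <= m < n.+1) (m == r) =
            \sum_(1 <= m < n.+1) (shift a i (part a j) j m == r) +
            \sum_(1 <= m < n.+1) (shift a j (part a k) k m == r).
    rewrite -!big_split /=; apply: eq_bigr => m _; rewrite /f.
    case: leqP => hm.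
      by case: (shiftP a j (part a k)) => *; lia.
    by case: (shiftP a i (part a j)) => *; lia.
  by rewrite /f'; lia.
(* Label [j] slides under [f] but not under [f'], as its part differs from that of [k]. *)
- rewrite /f leqnn /f'; case: shiftP => [s *|]; last by lia.
  by case: shiftP => *; lia.
Qed.

(** * A slide of [k] combined with a move of [l] *)

Section Pair.

Variables (a : wcomp) (i j k l : nat).

Hypotheses (hij : 0 < i < j) (hjk : j < k < l) (aik : part a i < part a k).
Hypothesis jk_neq : forall p, j < p < k -> part a p <> part a k.

Let g := shift a i (part a k) k.

Lemma shift_k_le : g k <= j.
Proof.
rewrite /g; case: shiftP => [s _ _ hs [->|[_ e]] _|]; try by lia.
by have := @jk_neq s; lia.
Qed.

(** The moves are [k -> i] and [l -> j] in the last columns. For [part a k = (part a l).+1] label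
    [k] would stand above [l] and next drop to row [j] or lower, breaking the crossing condition. *)
Lemma valid_outer :
    part a j < part a l -> part a l = part a k \/ (part a l).+1 < part a k ->
    (forall p, j < p < l -> part a p = part a l -> p = k) ->
  valid a (update g l j) k k.
Proof.
move=> ajl alk none; have gk := shift_k_le.
apply: valid_unmoved; first by lia.
- move=> m m0 am; rewrite /update; case: eqP => [->|_]; first by lia.
  by rewrite /g; case: shiftP => *; lia.
- move=> p q lpq apq; rewrite /update.
  case: (eqVneq q l) => [ql|ql]; case: (eqVneq p l) => [pl|pl]; try by lia.
  + subst q; have [pj|pj] := ltnP p j.
      by rewrite /g; case: shiftP => *; lia.
    (* Label [k] lands strictly below row [j], since [j] is not in the chain. *)
    have pk : p = k.
      by apply: none; rewrite ?apq //; case: (eqVneq p j) => [pj'|]; [subst p|]; lia.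
    subst p; move: gk; rewrite /g.
    case: shiftP => [s h1 _ h2 [->|[h3 h4]] _|]; try by lia.
    by case: (eqVneq s j) => [sj|]; [subst s|]; lia.
  + by subst p; rewrite /g; case: shiftP => *; lia.
  + by apply: shift_mono; lia.
- move=> p q lpq apq; rewrite /update.
  case: (eqVneq q l) => [ql|ql]; first by move=> jp; subst q p; lia.
  rewrite /g; case: shiftP => [s h1 h2 h3 [->|h4] h5|_] e; subst; lia.
- move=> p q lpq aq apq; rewrite /update.
  case: (eqVneq q l) => [ql|ql]; case: (eqVneq p l) => [pl|pl]; try by lia.
  + by subst q; rewrite /g; case: shiftP => *; lia.
  + by subst p; rewrite /g; case: shiftP => *; lia.
  + rewrite /g; case: (shiftP a i (part a k) k q) => [s h1 h2 h3 _ _|_]; last by lia.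
    by case: shiftP => *; lia.
Qed.

(** Label [l] takes row [k] in its last column and the penultimate cell of [k] drops to row [j]. For
    equal parts the net effect is [l -> i] in the last column and [k -> j] before it; otherwise this
    relabels the diagram of [k -> i], [l -> j]. *)
Lemma valid_inner :
    (part a j).+1 < part a k ->
    part a l = part a k \/ (part a l).+1 = part a k ->
    (forall p, j < p < k -> (part a p).+1 <> part a k) ->
    (forall p, k < p < l -> part a p <> part a l) ->
  valid a (update g l k) k j.
Proof.
move=> ajk alk none1 none2; have gk := shift_k_le.
split.
- move=> m m0 am; rewrite /update; case: eqP => [->|_]; first by lia.
  by rewrite /g; case: shiftP => *; lia.
- by rewrite /update; case: eqP => [kl|_]; lia.
- move=> p q lpq apq; rewrite /update.
  case: (eqVneq q l) => [ql|ql]; case: (eqVneq p l) => [pl|pl]; try by lia.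
  + subst q; case: (ltngtP p k) => [pk|pk|->]; last by lia.
      by rewrite /g; case: shiftP => *; lia.
    by have := @none2 p; lia.
  + by subst p; rewrite /g; case: shiftP => *; lia.
  + by apply: shift_mono; lia.
- move=> p q lpq apq; rewrite /update.
  (* Row [k] is free for [l]: the penultimate cell of [k] has left it. *)
  case: (eqVneq q l) => [ql|ql]; first by move=> jp; subst q p; lia.
  rewrite /g; case: shiftP => [s h1 h2 h3 [->|h4] h5|_] e; subst; lia.
- move=> p q lpq aq apq; rewrite /update.
  case: (eqVneq q l) => [ql|ql]; case: (eqVneq p l) => [pl|pl]; try by lia.
  + by subst q; rewrite /g; case: shiftP => *; lia.
  + by subst p; rewrite /g; case: shiftP => *; lia.
  + rewrite /g; case: (shiftP a i (part a k) k q) => [s h1 h2 h3 _ _|_]; last by lia.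
    by case: shiftP => *; lia.
- move=> p hp ap apk; rewrite /update; case: eqP => [pl|_]; first by lia.
  have pj : p <> j by move=> pj; subst p; lia.
  by have := @none1 p; rewrite /g; case: shiftP => *; lia.
- move=> p hp apk; split; first by move=> jp; subst p; lia.
  by move=> akp jp; have := @jk_neq p; lia.
- move=> q hq aq akq; rewrite /update; case: eqP => [ql|_]; first by lia.
  by rewrite /g; case: shiftP => *; lia.
- move=> q hq aq akq; rewrite /update; case: eqP => [ql|_]; first by lia.
  by rewrite /g; case: shiftP => *; lia.
Qed.

End Pair.

(** * Patterns of four labels *)

Lemma first_after (P : pred nat) j k : j < k -> P k ->
  exists k', [/\ j < k' <= k, P k' & forall p, j < p < k' -> ~~ P p].
Proof.
move=> jk Pk; have ex : exists n, (j < n) && P n by exists k; rewrite jk.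
case: (ex_minnP ex) => n /andP[jn Pn] nmin; exists n; split=> //.
  by rewrite jn nmin // jk.
move=> p /andP[jp pn]; apply/negP => Pp.
by have := nmin p; rewrite jp Pp leqNgt pn => /(_ isT).
Qed.

(** Without intermediate labels of the same part both chains consist of one label, so two updates
    replace the slides. *)
Lemma valid_drop2 (a : wcomp) i j k l :
    0 < i < j -> j < k < l ->
    part a i < part a l -> part a j < part a l -> part a l < part a k ->
    (forall p, i < p < l -> part a p <> part a l) ->
    (forall p, j < p < k -> part a p <> part a k) ->
  valid a (update (update id k j) l i) k k.
Proof.
move=> hij hjk ai aj ak none1 none2; apply: valid_unmoved; rewrite /update; first by lia.
- move=> m m0 am; case: eqP => [->|_]; first by lia.
  by case: eqP => [->|_]; lia.
- move=> p q lpq apq.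
  have ip : p = i -> part a p = part a i by move->.
  have jp : p = j -> part a p = part a j by move->.
  have := none1 p; have := none2 p.
  by case: (eqVneq q l) => [ql|ql]; case: (eqVneq q k) => [qk|qk];
    case: (eqVneq p l) => [pl|pl]; case: (eqVneq p k) => [pk|pk];
    subst; lia.
- move=> p q lpq apq.
  have ip : p = i -> part a p = part a i by move->.
  have jp : p = j -> part a p = part a j by move->.
  by case: (eqVneq q l) => [ql|ql]; case: (eqVneq q k) => [qk|qk]; subst; lia.
- move=> p q lpq aq apq.
  by case: (eqVneq q l) => [ql|ql]; case: (eqVneq q k) => [qk|qk];
    case: (eqVneq p l) => [pl|pl]; case: (eqVneq p k) => [pk|pk];
    subst; lia.
Qed.

Lemma drop2_not_multiplicity_free (a : wcomp) i j k l :
    strong a -> 0 < i < j -> j < k < l ->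
    part a i < part a l -> part a j < part a l -> part a l < part a k ->
    (forall p, j < p < k -> part a p <= part a l) ->
    (forall p, k < p < l -> part a p <> part a l) ->
  ~ key_multiplicity_free a.
Proof.
move=> sa hij hjk ai aj ak nok nol.
(* Such a label gives the increasing triple [i < p < k]. *)
case: (boolP (has (fun p => part a p == part a l) (index_iota i.+1 k))).
  case/hasP => p; rewrite mem_index_iota => hp /eqP ap.
  by apply: (@increasing_not_multiplicity_free a i p k); lia.
move=> /hasPn no.
have noi p : i < p < l -> part a p <> part a l.
  move=> hp; case: (ltngtP p k) => [pk|pk|->]; [|by apply: nol; lia|by lia].
  by apply/eqP/no; rewrite mem_index_iota; lia.
have nojk p : j < p < k -> part a p <> part a k by move=> /nok; lia.
have ln : 0 < l <= size a by have := @part_gt0 a l; lia.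
pose g := shift a i (part a k) k.
have gl : g l = l by rewrite /g; case: shiftP => *; lia.
have sumT r := @sum_update (update id k j) l i (size a) r ln.
have sumT' r := @sum_update id k j (size a) r.
have sumU x r := @sum_update g l x (size a) r ln.
have sumg r := @sum_shift a i (part a k) k (size a) r.
rewrite -/g in sumg.
have ul : update id k j l = l by rewrite /update; case: eqP => //; lia.
have kl : (k == l) = false by lia.
have rowT : row_system a (rows a (update (update id k j) l i) k k).
  by apply: valid_row_system; [lia | apply: valid_drop2].
have [ekl|ekl] := eqVneq (part a k) (part a l).+1.
  apply: (@not_multiplicity_free a k k j (update (update id k j) l i)
            (update g l k) l) => //; try by lia.
  - apply: valid_row_system; [lia | apply: valid_inner => //; try by lia].
    by move=> p hp e; apply: (noi p); lia.
  - move=> r; have := sumT r; have := sumT' r; have := sumU k r; have := sumg r.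
    by rewrite ul gl /=; lia.
  - by rewrite /update eqxx; lia.
apply: (@not_multiplicity_free a k k k (update (update id k j) l i)
          (update g l j) l) => //; try by lia.
- apply: valid_row_system; [lia | apply: valid_outer => //; try by lia].
  by move=> p hp e; have := noi p; lia.
- move=> r; have := sumT r; have := sumT' r; have := sumU j r; have := sumg r.
  by rewrite ul gl /=; lia.
- by rewrite /update eqxx; lia.
Qed.

Lemma equal_last_not_multiplicity_free (a : wcomp) i j k l :
    strong a -> 0 < i < j -> j < k < l ->
    part a i < part a k -> (part a j).+1 < part a k -> part a k = part a l ->
    (forall p, j < p < k -> part a p <> part a k) ->
    (forall p, k < p < l -> part a p <> part a l) ->
  ~ key_multiplicity_free a.
Proof.
move=> sa hij hjk ai aj akl nok nol.
(* Such a label gives the increasing triple [j < p < k]. *)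
case: (boolP (has (fun p => (part a p).+1 == part a k) (index_iota j.+1 k))).
  case/hasP => p; rewrite mem_index_iota => hp /eqP ap.
  by apply: (@increasing_not_multiplicity_free a j p k); lia.
move=> /hasPn no.
have ln : 0 < l <= size a by have := @part_gt0 a l; lia.
pose g := shift a i (part a k) k.
(* Both tableaux use the slide [g]; the last cell of [l] and the penultimate cell of [k] swap rows
   [j] and [k]. *)
apply: (@not_multiplicity_free a k j k (update g l k) (update g l j) l) => //;
  try by lia.
- apply: valid_row_system; [lia | apply: valid_inner => //; try by lia].
  by move=> p hp; apply/eqP/no; rewrite mem_index_iota; lia.
- apply: valid_row_system; [lia | apply: valid_outer => //; try by lia].
  move=> p hp e; case: (ltngtP p k) => // pk.
    by case: (nok p); lia.
  by case: (nol p); lia.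
- move=> r; have := @sum_update g l k (size a) r ln; have := @sum_update g l j (size a) r ln.
  by lia.
- by rewrite /update eqxx; lia.
Qed.

Theorem theorem4p1 (alpha : wcomp) (alpha_strong : strong alpha) :
  [/\ (exists i j k : nat,
         0 < i < j /\ j < k <= size alpha /\
         part alpha i < part alpha j < part alpha k) ->
      ~ key_multiplicity_free alpha,
      (exists i j k l : nat,
         0 < i < j /\ j < k < l /\ l <= size alpha /\
         [/\ part alpha i < part alpha l, part alpha j < part alpha l
           & part alpha l < part alpha k]) ->
      ~ key_multiplicity_free alpha
    & (exists i j k l : nat,
         0 < i < j /\ j < k < l /\ l <= size alpha /\
         [/\ part alpha i < part alpha k, part alpha j + 1 < part alpha k
           & part alpha k = part alpha l]) ->
      ~ key_multiplicity_free alpha].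
Proof.
split=> [[i [j [k [hij [hjk h]]]]]|[i [j [k [l [hij [hjkl [_ [ai aj ak]]]]]]]]|
         [i [j [k [l [hij [hjkl [_ [ai aj ak]]]]]]]]].
- by apply: (increasing_not_multiplicity_free alpha_strong hij _ h); lia.
- have /andP[jk _] := hjkl.
  (* The part of [k'] may differ from that of [k]; it only has to exceed [part alpha l]. *)
  have [k' [hk ak' nok]] :=
    @first_after (fun p => part alpha l < part alpha p) _ _ jk ak.
  have kl : k' < l by lia.
  have [l' [hl /eqP al nol]] :=
    @first_after (fun p => part alpha p == part alpha l) _ _ kl (eqxx _).
  apply: (@drop2_not_multiplicity_free alpha i j k' l'); rewrite ?al //; try by lia.
    by move=> p /nok; rewrite -leqNgt.
  by move=> p /nol /eqP.
- have /andP[jk _] := hjkl.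
  have [k' [hk /eqP ak' nok]] :=
    @first_after (fun p => part alpha p == part alpha k) _ _ jk (eqxx _).
  have kl : k' < l by lia.
  have [l' [hl /eqP al nol]] :=
    @first_after (fun p => part alpha p == part alpha l) _ _ kl (eqxx _).
  apply: (@equal_last_not_multiplicity_free alpha i j k' l');
    rewrite ?al ?ak' //; try by lia.
    by move=> p /nok /eqP.
  by move=> p /nol /eqP.
Qed.
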